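(* Let $S=(s_1,s_{n+1},s_2,s_{n+2},\ldots,s_n,s_{2n})\in\mathbb{R}^{2m,2n}$ satisfy $S^TJS=\widehat{J}_{2n}$. For $j=1,\ldots,n$ put $S_j=(s_j,s_{n+j})\in\mathbb{R}^{2m,2}$ and $\delta_j=\sqrt[4]{\det(S_j^TS_j)}$, and let $$\delta=\max_{j=1,\ldots,n}\delta_j,\qquad \mu=\min_{j=1,\ldots,n}\delta_j .$$ Let $\check{D}_c=\operatorname{diag}(\check{D}_1,\ldots,\check{D}_n)$, where for $j=1,\ldots,n$ $$\check{D}_j=\begin{pmatrix}\check c_{jj}&\check f_{jj}\\0&\check c_{jj}^{-1}\end{pmatrix},\qquad \check c_{jj}=\frac{\|s_j\|_2}{\delta},\qquad \check f_{jj}=\frac{s_j^Ts_{n+j}\pm\sqrt{\delta^4-\det(S_j^TS_j)}}{\|s_j\|_2\,\delta}$$ (with either choice of sign for each $j$). Then $$\min_{D\in\mathcal{D}}\kappa_2(SD^{-1})\le\kappa_2(S\check{D}_c^{-1})\le\sqrt{2n}\;\frac{\delta\sqrt{\delta^2+\sqrt{\delta^4-\mu^4}}}{\mu^2}\;\min_{D\in\mathcal{D}}\kappa_2(SD^{-1}).$$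
   Context: Here $m\ge n$, $J=\begin{pmatrix}0&I\\-I&0\end{pmatrix}\in\mathbb{R}^{2m,2m}$ with $I$ the $m\times m$ identity, and $\widehat{J}_{2n}=\operatorname{diag}(J_1,\ldots,J_1)\in\mathbb{R}^{2n,2n}$ ($n$ copies) with $J_1=\begin{pmatrix}0&1\\-1&0\end{pmatrix}$. The columns of $S$ are labelled in the order $s_1,s_{n+1},s_2,s_{n+2},\ldots,s_n,s_{2n}$, so $S_j$ consists of columns $2j-1$ and $2j$ of $S$. For a matrix $X$ of full column rank, $\kappa_2(X)=\sigma_{\max}(X)/\sigma_{\min}(X)$ is the spectral condition number. $\mathcal{D}$ is the set of all real $2n\times 2n$ block diagonal matrices $D=\operatorname{diag}(D_1,\ldots,D_n)$ whose $2\times2$ diagonal blocks have the form $D_j=\begin{pmatrix}c_{jj}&f_{jj}\\0&c_{jj}^{-1}\end{pmatrix}$ with $c_{jj}\in\mathbb{R}\setminus\{0\}$, $f_{jj}\in\mathbb{R}$. *)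

(* Defs.v *)
From HB Require Import structures.
From mathcomp Require Import all_boot all_order all_algebra.
From mathcomp Require Import boolp classical_sets reals exp.

Set Implicit Arguments.
Unset Strict Implicit.
Unset Printing Implicit Defensive.

Import Order.TTheory GRing.Theory Num.Theory.

Local Open Scope classical_set_scope.
Local Open Scope ring_scope.

Section Norms.
Context {R : realType}.

(* The Euclidean norm: the library norm `|_| on matrices is the sup norm. *)
Definition norm2 p (v : 'cV[R]_p) : R := Num.sqrt (\sum_(i < p) v i 0 ^+ 2).

(* Square roots of the eigenvalues of X^T X; these are the singular values of
   X when q <= p (a wide matrix would get spurious zeros). *)
Definition singular_values p q (X : 'M[R]_(p, q)) : set R :=
  [set s | 0 <= s /\ eigenvalue (X^T *m X) (s ^+ 2)].

(* The set of singular values is finite, and nonempty when 0 < q, so sup and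
   inf are then its largest and smallest element. *)
Definition sigma_max p q (X : 'M[R]_(p, q)) : R := sup (singular_values X).
Definition sigma_min p q (X : 'M[R]_(p, q)) : R := inf (singular_values X).

Definition kappa2 p q (X : 'M[R]_(p, q)) : R := sigma_max X / sigma_min X.

Definition is_min (A : set R) (x : R) : Prop := A x /\ lbound A x.

End Norms.

Section Symplectic.
Context {R : realType}.

Definition mx2 (a b c d : R) : 'M[R]_2 :=
  \matrix_(i < 2, j < 2) (nth [::] [:: [:: a; b]; [:: c; d]] i)`_j.

Definition Jmx (m : nat) : 'M[R]_(m + m) := block_mx 0 1%:M (- 1%:M) 0.

(* Matrices with 2n columns are given the column index type
   'I_(\sum_(j < n) 2) of the library's block matrices, n blocks of width 2. *)
Definition Jhat (n : nat) : 'M[R]_(\sum_(j < n) 2) :=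
  \mxdiag_(j < n) mx2 0 1 (-1) 0.

Definition Dblock (c f : R) : 'M[R]_2 := mx2 c f 0 c^-1.

Definition Dset (n : nat) : set 'M[R]_(\sum_(j < n) 2) :=
  [set D | exists c f : 'I_n -> R,
     (forall j, c j != 0) /\ D = \mxdiag_(j < n) Dblock (c j) (f j)].

Variables (m n : nat) (S : 'M[R]_(m + m, \sum_(j < n) 2)).

Definition Sblk (j : 'I_n) : 'M[R]_(m + m, 2) := submxrow S j.

(* With j counted from 0, these are s_(j+1) and s_(n+j+1): S lists its columns
   as s_1, s_(n+1), s_2, s_(n+2), ..., s_n, s_(2n). *)
Definition scol (j : 'I_n) : 'cV[R]_(m + m) := col 0 (Sblk j).
Definition scoln (j : 'I_n) : 'cV[R]_(m + m) := col 1 (Sblk j).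

Definition detS (j : 'I_n) : R := \det ((Sblk j)^T *m Sblk j).

Definition delta_ (j : 'I_n) : R := detS j `^ 4^-1.

(* The default values 0 and deltamax are harmless when 0 < n, because
   0 <= delta_ j <= deltamax. *)
Definition deltamax : R := \big[Num.max/0]_(j < n) delta_ j.
Definition deltamin : R := \big[Num.min/deltamax]_(j < n) delta_ j.

Definition ccheck (j : 'I_n) : R := norm2 (scol j) / deltamax.

(* sgn selects the sign: + for false, - for true. *)
Definition fcheck (sgn : 'I_n -> bool) (j : 'I_n) : R :=
  (((scol j)^T *m scoln j) 0 0
     + (-1) ^+ sgn j * Num.sqrt (deltamax ^+ 4 - detS j))
  / (norm2 (scol j) * deltamax).

Definition Dcheck (sgn : 'I_n -> bool) : 'M[R]_(\sum_(j < n) 2) :=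
  \mxdiag_(j < n) Dblock (ccheck j) (fcheck sgn j).

End Symplectic.

Arguments Jmx {R} m.
Arguments Jhat {R} n.
Arguments Dset {R} n.

(* Main.v *)
(** Write [Y = S D^-1] for [D] in [Dset] and [X = S Dc^-1] for the scaling of
    the theorem.  Every column of [X] has norm [delta], so the Frobenius norm
    gives [sigma_max X <= sqrt (2n) delta].  The Gram matrix of the j-th block
    of [X] is [[delta^2, -+h_j], [-+h_j, delta^2]] with
    [h_j^2 = delta^4 - delta_j^4 <= H^2 := delta^4 - mu^4], so that block
    stretches every vector by at least [sqrt (delta^2 - H)].  If [X v = Y w],
    the blocks satisfy [X_j v_j = Y_j w_j], hence
    [sqrt (delta^2 - H) |v| <= sigma_max Y |w|], while
    [sigma_min Y |w| <= |Y w| = |X v|]; this bounds [sigma_min X] from below.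
    The minimum over [D] is attained: the blocks [D_j] have determinant 1, so
    [sigma_min Y <= sigma_max S], and therefore a sublevel set of
    [kappa2 (S D^-1)] is bounded in the parameters and stays away from
    [c_jj = 0]; on a compact set of such parameters [kappa2] is continuous. *)
Require Import Defs.
From mathcomp Require Import all_boot all_order all_algebra ring lra.
From mathcomp Require Import boolp classical_sets reals exp.
From mathcomp Require Import functions topology normedtype derive realfun.
Set Implicit Arguments.
Unset Strict Implicit.
Unset Printing Implicit Defensive.

Import Order.TTheory GRing.Theory Num.Theory.
Import numFieldNormedType.Exports.
Local Open Scope classical_set_scope.
Local Open Scope ring_scope.

(** * Inner product, Euclidean norm and Frobenius norm *)

Section EuclideanNorm.
Context {R : realType}.

Definition dot p (u v : 'cV[R]_p) : R := (u^T *m v) 0 0.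

Lemma dotE p (u v : 'cV[R]_p) : dot u v = \sum_i u i 0 * v i 0.
Proof. by rewrite /dot mxE; apply: eq_bigr => i _; rewrite mxE. Qed.

Lemma dotC p (u v : 'cV[R]_p) : dot u v = dot v u.
Proof. by rewrite !dotE; apply: eq_bigr => i _; rewrite mulrC. Qed.

Lemma dotDl p (u v w : 'cV[R]_p) : dot (u + v) w = dot u w + dot v w.
Proof.
by rewrite !dotE -big_split; apply: eq_bigr => i _; rewrite mxE mulrDl.
Qed.

Lemma dotDr p (u v w : 'cV[R]_p) : dot w (u + v) = dot w u + dot w v.
Proof. by rewrite !(dotC w) dotDl. Qed.

Lemma dotZl p a (u v : 'cV[R]_p) : dot (a *: u) v = a * dot u v.
Proof.
by rewrite !dotE mulr_sumr; apply: eq_bigr => i _; rewrite mxE mulrA.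
Qed.

Lemma dotZr p a (u v : 'cV[R]_p) : dot u (a *: v) = a * dot u v.
Proof. by rewrite !(dotC u) dotZl. Qed.

Lemma dot_mull p q (A : 'M[R]_(p, q)) (u : 'cV[R]_q) (v : 'cV[R]_p) :
  dot (A *m u) v = dot u (A^T *m v).
Proof. by rewrite /dot trmx_mul mulmxA. Qed.

Lemma norm2_ge0 p (v : 'cV[R]_p) : 0 <= norm2 v.
Proof. exact: sqrtr_ge0. Qed.

Lemma sqr_norm2 p (v : 'cV[R]_p) : norm2 v ^+ 2 = dot v v.
Proof.
rewrite sqr_sqrtr; last by apply: sumr_ge0 => i _; exact: sqr_ge0.
by rewrite dotE.
Qed.

Lemma norm2_gt0 p (v : 'cV[R]_p) : (0 < norm2 v) = (v != 0).
Proof.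
rewrite lt_neqAle norm2_ge0 andbT eq_sym; congr negb.
rewrite sqrtr_eq0 le_eqVlt ltNge sumr_ge0 ?orbF; last by move=> *; exact: sqr_ge0.
apply/eqP/eqP => [/psumr_eq0P v0|->]; last first.
  by apply: big1 => i _; rewrite mxE expr0n.
apply/colP => i; rewrite mxE; apply/eqP; rewrite -sqrf_eq0; apply/eqP/v0 => //.
by move=> *; exact: sqr_ge0.
Qed.

Lemma norm2Z p a (v : 'cV[R]_p) : norm2 (a *: v) = `|a| * norm2 v.
Proof.
rewrite -sqrtr_sqr -sqrtrM ?sqr_ge0// mulr_sumr; congr Num.sqrt.
by apply: eq_bigr => i _; rewrite mxE exprMn.
Qed.

Lemma sqr_norm2D p (u v : 'cV[R]_p) :
  norm2 (u + v) ^+ 2 = norm2 u ^+ 2 + 2 * dot u v + norm2 v ^+ 2.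
Proof. by rewrite !sqr_norm2 dotDl !dotDr (dotC v u); ring. Qed.

Lemma cauchy_schwarz p (u v : 'cV[R]_p) :
  dot u v ^+ 2 <= norm2 u ^+ 2 * norm2 v ^+ 2.
Proof.
have [->|u0] := eqVneq u 0.
  rewrite dotE big1 ?expr0n//= ?mulr_ge0 ?exprn_ge0 ?norm2_ge0//.
  by move=> i _; rewrite mxE mul0r.
have a0 : 0 < norm2 u ^+ 2 by rewrite exprn_gt0// norm2_gt0.
(* This vector is |u|^2 times the component of [v] orthogonal to [u]; its squared norm is |u|^2
   (|u|^2 |v|^2 - <u,v>^2). *)
have := sqr_ge0 (norm2 (norm2 u ^+ 2 *: v + (- dot u v) *: u)).
rewrite sqr_norm2D !norm2Z dotZl dotZr (dotC v u) !exprMn !real_normK ?num_real//.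
move=> h; rewrite -(ler_pM2l a0); nra.
Qed.

Lemma norm2D p (u v : 'cV[R]_p) : norm2 (u + v) <= norm2 u + norm2 v.
Proof.
have uv : dot u v <= norm2 u * norm2 v.
  rewrite (le_trans (ler_norm _))// -ler_sqr ?nnegrE ?mulr_ge0 ?norm2_ge0//.
  by rewrite real_normK ?num_real// exprMn cauchy_schwarz.
rewrite -ler_sqr ?nnegrE ?addr_ge0 ?norm2_ge0// sqr_norm2D.
by nra.
Qed.

Definition frobenius p q (A : 'M[R]_(p, q)) : R :=
  Num.sqrt (\sum_i \sum_j A i j ^+ 2).

Lemma norm2_mulmx_le p q (A : 'M[R]_(p, q)) (v : 'cV[R]_q) :
  norm2 (A *m v) <= frobenius A * norm2 v.
Proof.
rewrite -sqrtrM; last first.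
  by apply: sumr_ge0 => i _; apply: sumr_ge0 => j _; exact: sqr_ge0.
apply: ler_wsqrtr; rewrite mulr_suml; apply: ler_sum => i _.
rewrite -[A in A *m v]trmxK (_ : (_ *m v) i 0 = dot (col i A^T) v); last first.
  by rewrite dotE mxE; apply: eq_bigr => j _; rewrite !mxE.
apply: le_trans (cauchy_schwarz _ _) _; rewrite !sqr_norm2 !dotE.
rewrite le_eqVlt; apply/orP; left; apply/eqP; congr (_ * _).
by apply: eq_bigr => j _; rewrite !mxE expr2.
Qed.

Lemma norm2_mulmx p q (A : 'M[R]_(p, q)) (v : 'cV[R]_q) :
  norm2 (A *m v) ^+ 2 = dot v (A^T *m A *m v).
Proof. by rewrite sqr_norm2 dot_mull mulmxA. Qed.

(** With z = B u, the form at u + t z equals 2 t |z|^2 + t^2 <z, B z>. Being nonnegative for every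
    t, it cannot have a nonzero linear term. *)
Lemma psd_kernel q (B : 'M[R]_q) (u : 'cV[R]_q) : B^T = B ->
  (forall w : 'cV[R]_q, 0 <= dot w (B *m w)) ->
  dot u (B *m u) = 0 -> B *m u = 0.
Proof.
move=> Bsym B0 u0; set z := B *m u.
have key t : 0 <= 2 * t * norm2 z ^+ 2 + t ^+ 2 * dot z (B *m z).
  have := B0 (u + t *: z).
  rewrite mulmxDr -scalemxAr dotDl !dotDr !dotZl !dotZr u0 add0r.
  by rewrite -[in dot u _]Bsym -dot_mull -/z sqr_norm2; nra.
apply/eqP; rewrite -[_ == _]negbK -norm2_gt0 -leNgt; set s := norm2 z in key *.
have g0 := B0 z; set g := dot z _ in key g0.
(* The choice t = -|z|^2 / (1 + g) avoids dividing by [g], which may be 0. With i = 1 / (1 + g) the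
   bound becomes 0 <= - i |z|^4 (1 + i). *)
have := key (- ((1 + g)^-1 * s ^+ 2)).
have : 0 < (1 + g)^-1 by rewrite invr_gt0; lra.
have : (1 + g)^-1 * (1 + g) = 1 by rewrite mulVf// gt_eqF//; lra.
move: (1 + g)^-1 => i i1 i0.
have -> : 2 * - (i * s ^+ 2) * s ^+ 2 + (- (i * s ^+ 2)) ^+ 2 * g =
  - (i * s ^+ 4 * (2 - i * g)) by ring.
have -> : i * g = 1 - i by rewrite -i1; ring.
rewrite oppr_ge0 pmulr_lle0; last lra.
by rewrite pmulr_rle0// exprn_even_le0//= => /eqP ->.
Qed.

End EuclideanNorm.

(** * Extreme singular values: variational description and continuity *)

Section SingularValues.
Context {R : realType}.

Lemma continuous_sum (T : topologicalType) (I : finType) (f : I -> T -> R) (t : T) :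
  (forall i, {for t, continuous (f i)}) ->
  {for t, continuous (fun s => \sum_i f i s)}.
Proof.
move=> ft; elim: (index_enum I) => [|i r IH].
  rewrite (_ : (fun s => _) = cst 0); first exact: cst_continuous.
  by apply/funext => s; rewrite big_nil.
rewrite (_ : (fun s => _) = (fun s => f i s + \sum_(j <- r) f j s)).
  by apply: continuousD; [exact: ft|exact: IH].
by apply/funext => s; rewrite big_cons.
Qed.

Lemma continuous_dot_mulmx q (A : 'M[R]_q) :
  continuous (fun w : 'rV[R]_q => dot w^T (A *m w^T)).
Proof.
have -> : (fun w : 'rV[R]_q => dot w^T (A *m w^T)) =
    (fun w => \sum_i w 0 i * \sum_j A i j * w 0 j).
  apply/funext => w; rewrite dotE; apply: eq_bigr => i _; rewrite !mxE.
  by congr (_ * _); apply: eq_bigr => j _; rewrite mxE.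
move=> w; apply: continuous_sum => i; apply: continuousM.
  exact: coord_continuous.
apply: continuous_sum => j; apply: continuousM; first exact: cst_continuous.
exact: coord_continuous.
Qed.

(** Heine-Borel: the Euclidean norm dominates every coordinate, hence the sup norm, and the sphere
    is the preimage of 1 under the quadratic form of the identity. Row vectors are used because
    [EVT_min_rV] is about them. *)
Lemma compact_sphere q : compact [set w : 'rV[R]_q | norm2 w^T = 1].
Proof.
apply: bounded_closed_compact.
  exists 1; split; first exact: num_real.
  move=> M M1 w /= w1; rewrite [leLHS]/Num.norm/= mx_normrE.
  apply: bigmax_le => [|[i j] _] /=; first by rewrite ltW// (lt_trans _ M1).
  rewrite (le_trans _ (ltW M1))// -(@ler_sqr _ `|_|) ?nnegrE// real_normK ?num_real//.
  rewrite ord1 -w1 sqr_norm2 dotE (bigD1 j)//= !mxE -expr2 lerDl.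
  by apply: sumr_ge0 => k _; rewrite -expr2 sqr_ge0.
have -> : [set w : 'rV[R]_q | norm2 w^T = 1] =
    (fun w : 'rV[R]_q => dot w^T (1%:M *m w^T)) @^-1` [set 1].
  apply/seteqP; split => w /=; rewrite mul1mx -sqr_norm2.
    by move=> ->; rewrite expr1n.
  by move/eqP; rewrite sqrp_eq1 ?norm2_ge0// => /eqP.
apply: preimage_closed; last exact: closed_eq.
by move=> w _; exact: continuous_dot_mulmx.
Qed.

(* A minimiser [u] of the quadratic form of [A] on the unit sphere is in the
   kernel of the positive semidefinite matrix [A - (min)]. *)
Lemma rayleigh_min q (A : 'M[R]_q) : (0 < q)%N -> A^T = A ->
  exists2 l : R, (exists2 u : 'cV[R]_q, u != 0 & A *m u = l *: u) &
    forall w : 'cV[R]_q, l * norm2 w ^+ 2 <= dot w (A *m w).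
Proof.
move=> q0 Asym; set sph := [set w : 'rV[R]_q | norm2 w^T = 1].
have sph0 : sph !=set0.
  pose e : 'cV[R]_q := delta_mx (Ordinal q0) 0.
  exists e^T; rewrite /sph/= trmxK /norm2 (bigD1 (Ordinal q0))//=.
  rewrite big1 ?addr0; first by rewrite mxE !eqxx expr1n sqrtr1.
  by move=> i /negbTE iq; rewrite mxE iq expr0n.
have [|u] := EVT_min_rV sph0 (@compact_sphere q) (f := fun w => dot w^T (A *m w^T)).
  by apply: continuous_subspaceT; exact: continuous_dot_mulmx.
rewrite inE => u1 umin; set l := dot _ _ in umin.
have lmin (w : 'cV[R]_q) : l * norm2 w ^+ 2 <= dot w (A *m w).
  have [->|w0] := eqVneq w 0.
    rewrite mulmx0 /norm2 /dot mulmx0 mxE big1 ?sqrtr0 ?expr0n ?mulr0//.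
    by move=> i _; rewrite mxE expr0n.
  have n0 : 0 < norm2 w by rewrite norm2_gt0.
  have := umin ((norm2 w)^-1 *: w)^T; rewrite inE => /(_ _).
  rewrite /sph/= trmxK norm2Z ger0_norm ?invr_ge0 ?norm2_ge0//.
  rewrite mulVf ?gt_eqF// => /(_ erefl).
  rewrite -scalemxAr dotZl dotZr mulrA -invfM mulrC ler_pdivlMr ?mulr_gt0//.
exists l => //; exists u^T.
  by rewrite -norm2_gt0 u1.
have : (A - l%:M) *m u^T = 0.
  apply: psd_kernel.
  - by rewrite linearB/= Asym tr_scalar_mx.
  - move=> w; rewrite mulmxBl mul_scalar_mx -scaleN1r scalerA mulN1r.
    by rewrite dotDr dotZr -sqr_norm2 mulNr subr_ge0.
  - rewrite mulmxBl mul_scalar_mx -scaleN1r scalerA mulN1r.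
    by rewrite dotDr dotZr -sqr_norm2 u1 expr1n mulr1 subrr.
by rewrite mulmxBl mul_scalar_mx => /eqP; rewrite subr_eq0 => /eqP.
Qed.

Lemma gram_sym p q (X : 'M[R]_(p, q)) : (X^T *m X)^T = X^T *m X.
Proof. by rewrite trmx_mul trmxK. Qed.

(** [eigenvalue] speaks of row vectors; as the Gram matrix is symmetric, transposing yields column
    eigenvectors. *)
Lemma singular_valuesP p q (X : 'M[R]_(p, q)) (s : R) : singular_values X s <->
  0 <= s /\ exists2 u : 'cV[R]_q, u != 0 & X^T *m X *m u = s ^+ 2 *: u.
Proof.
split=> [[s0 /eigenvalueP[v vX v0]]|[s0 [u u0 uX]]]; split=> //.
  exists v^T; first by rewrite trmx_eq0.
  by rewrite -[X^T *m X]gram_sym -trmx_mul vX linearZ.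
apply/eigenvalueP; exists u^T; last by rewrite trmx_eq0.
by rewrite -[X^T *m X]gram_sym -trmx_mul uX linearZ.
Qed.

Lemma norm2_singular_vector p q (X : 'M[R]_(p, q)) (s : R) (u : 'cV[R]_q) :
  0 <= s -> X^T *m X *m u = s ^+ 2 *: u -> norm2 (X *m u) = s * norm2 u.
Proof.
move=> s0 Xu; apply/eqP; rewrite -(eqrXn2 (n := 2))// ?mulr_ge0 ?norm2_ge0//.
by rewrite norm2_mulmx Xu dotZr -sqr_norm2 exprMn.
Qed.

(** The minimum [l] of the Rayleigh quotient is an eigenvalue of the Gram matrix, so its root both
    belongs to the singular values and bounds them below. The later estimates use this description
    instead of the infimum. *)
Lemma sigma_min_spec p q (X : 'M[R]_(p, q)) : (0 < q)%N ->
  [/\ 0 <= sigma_min X,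
      forall v, sigma_min X * norm2 v <= norm2 (X *m v) &
      exists2 u, u != 0 & norm2 (X *m u) = sigma_min X * norm2 u].
Proof.
move=> q0; have [l [u u0 Xu] lmin] := rayleigh_min q0 (gram_sym X).
have nu : 0 < norm2 u by rewrite norm2_gt0.
have l0 : 0 <= l.
  rewrite -(pmulr_lge0 _ (exprn_gt0 2 nu)) sqr_norm2 -dotZr -Xu -norm2_mulmx.
  exact: sqr_ge0.
have lE : Num.sqrt l ^+ 2 = l by rewrite sqr_sqrtr.
have lS : singular_values X (Num.sqrt l).
  by apply/singular_valuesP; split; [exact: sqrtr_ge0|exists u; rewrite ?lE].
have llb : lbound (singular_values X) (Num.sqrt l).
  move=> s /singular_valuesP[s0 [v v0 Xv]].
  rewrite -(ler_pM2r (_ : 0 < norm2 v)) ?norm2_gt0//.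
  rewrite -(norm2_singular_vector s0 Xv).
  rewrite -ler_sqr ?nnegrE ?mulr_ge0 ?norm2_ge0 ?sqrtr_ge0//.
  by rewrite exprMn lE norm2_mulmx.
have -> : sigma_min X = Num.sqrt l.
  apply/eqP; rewrite eq_le; apply/andP; split.
    by apply: ge_inf => //; exists (Num.sqrt l).
  by apply: lb_le_inf => //; exists (Num.sqrt l).
split; first exact: sqrtr_ge0.
  move=> v; rewrite -ler_sqr ?nnegrE ?mulr_ge0 ?norm2_ge0 ?sqrtr_ge0//.
  by rewrite exprMn lE norm2_mulmx.
by exists u => //; rewrite (@norm2_singular_vector _ _ _ (Num.sqrt l)) ?lE ?sqrtr_ge0.
Qed.

(** The Rayleigh argument applied to - X^T X, whose least eigenvalue is minus the largest one of X^T
    X. *)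
Lemma sigma_max_spec p q (X : 'M[R]_(p, q)) : (0 < q)%N ->
  [/\ 0 <= sigma_max X,
      forall v, norm2 (X *m v) <= sigma_max X * norm2 v &
      exists2 u, u != 0 & norm2 (X *m u) = sigma_max X * norm2 u].
Proof.
move=> q0; have NXsym : (- (X^T *m X))^T = - (X^T *m X) by rewrite linearN/= gram_sym.
have [l [u u0 NXu] lmin] := rayleigh_min q0 NXsym.
have nu : 0 < norm2 u by rewrite norm2_gt0.
have Xu : X^T *m X *m u = - l *: u by rewrite -[X^T *m X]opprK mulNmx NXu scaleNr.
have lmax v : norm2 (X *m v) ^+ 2 <= - l * norm2 v ^+ 2.
  have := lmin v; rewrite mulNmx -scaleN1r dotZr -norm2_mulmx; lra.
have l0 : 0 <= - l.
  rewrite -(pmulr_lge0 _ (exprn_gt0 2 nu)); exact: le_trans (sqr_ge0 _) (lmax u).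
(* From here on [l] stands for the negated minimum, the largest eigenvalue of X^T X. *)
move: (- l) Xu lmax l0 => {lmin NXu}{}l Xu lmax l0.
have lE : Num.sqrt l ^+ 2 = l by rewrite sqr_sqrtr.
have lS : singular_values X (Num.sqrt l).
  by apply/singular_valuesP; split; [exact: sqrtr_ge0|exists u; rewrite ?lE].
have lub : ubound (singular_values X) (Num.sqrt l).
  move=> s /singular_valuesP[s0 [v v0 Xv]].
  rewrite -(ler_pM2r (_ : 0 < norm2 v)) ?norm2_gt0//.
  rewrite -(norm2_singular_vector s0 Xv).
  rewrite -ler_sqr ?nnegrE ?mulr_ge0 ?norm2_ge0 ?sqrtr_ge0//.
  by rewrite exprMn lE.
have -> : sigma_max X = Num.sqrt l.
  apply/eqP; rewrite eq_le; apply/andP; split.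
    by apply: ge_sup => //; exists (Num.sqrt l).
  by apply: ub_le_sup => //; exists (Num.sqrt l).
split; first exact: sqrtr_ge0.
  move=> v; rewrite -ler_sqr ?nnegrE ?mulr_ge0 ?norm2_ge0 ?sqrtr_ge0//.
  by rewrite exprMn lE.
by exists u => //; rewrite (@norm2_singular_vector _ _ _ (Num.sqrt l)) ?lE ?sqrtr_ge0.
Qed.

Lemma sigma_max_le p q (X : 'M[R]_(p, q)) (k : R) : (0 < q)%N ->
  (forall v, norm2 (X *m v) <= k * norm2 v) -> sigma_max X <= k.
Proof.
move=> q0 Xk; have [_ _ [u u0 Xu]] := sigma_max_spec X q0.
by rewrite -(ler_pM2r (_ : 0 < norm2 u)) ?norm2_gt0// -Xu.
Qed.

Lemma sigma_min_ge p q (X : 'M[R]_(p, q)) (k : R) : (0 < q)%N ->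
  (forall v, k * norm2 v <= norm2 (X *m v)) -> k <= sigma_min X.
Proof.
move=> q0 Xk; have [_ _ [u u0 Xu]] := sigma_min_spec X q0.
by rewrite -(ler_pM2r (_ : 0 < norm2 u)) ?norm2_gt0// -Xu.
Qed.

Lemma sigma_min_gt0 p q (X : 'M[R]_(p, q)) : (0 < q)%N ->
  (forall v : 'cV_q, X *m v = 0 -> v = 0) -> 0 < sigma_min X.
Proof.
move=> q0 X0; have [s0 _ [u u0 Xu]] := sigma_min_spec X q0.
rewrite lt_neqAle s0 andbT eq_sym; apply: contraNneq u0 => sX.
by apply/eqP/X0/eqP; rewrite -[_ == _]negbK -norm2_gt0 Xu sX mul0r ltxx.
Qed.

Lemma norm2_mulmx_sub p q (X Y : 'M[R]_(p, q)) v :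
  norm2 (X *m v) <= norm2 (Y *m v) + frobenius (X - Y) * norm2 v.
Proof.
rewrite -[X in X *m v](subrK Y) mulmxDl addrC (le_trans (norm2D _ _))//.
by rewrite lerD2l norm2_mulmx_le.
Qed.

Lemma frobeniusB p q (X Y : 'M[R]_(p, q)) : frobenius (X - Y) = frobenius (Y - X).
Proof.
congr Num.sqrt; apply: eq_bigr => i _; apply: eq_bigr => j _.
by rewrite !mxE -sqrrN opprB.
Qed.

(** A perturbation bound of Weyl type, from the triangle inequality; exchanging [X] and [Y] reduces
    it to one side. *)
Lemma sigma_max_lip p q (X Y : 'M[R]_(p, q)) : (0 < q)%N ->
  `|sigma_max X - sigma_max Y| <= frobenius (X - Y).
Proof.
move=> q0; wlog suff le1 : X Y / sigma_max X - sigma_max Y <= frobenius (X - Y).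
  by rewrite ler_norml lerNl opprB le1 frobeniusB le1.
rewrite lerBlDl; apply: sigma_max_le => // v.
have [_ Yv _] := sigma_max_spec Y q0.
by rewrite (le_trans (norm2_mulmx_sub _ Y _))// mulrDl lerD2r.
Qed.

Lemma sigma_min_lip p q (X Y : 'M[R]_(p, q)) : (0 < q)%N ->
  `|sigma_min X - sigma_min Y| <= frobenius (X - Y).
Proof.
move=> q0; wlog suff le1 : X Y / sigma_min X - sigma_min Y <= frobenius (X - Y).
  by rewrite ler_norml lerNl opprB le1 frobeniusB le1.
rewrite lerBlDl -lerBlDr; apply: sigma_min_ge => // v.
have [_ Xv _] := sigma_min_spec X q0.
by rewrite mulrBl lerBlDr (le_trans (Xv v))// norm2_mulmx_sub.
Qed.

Lemma cvg_frobenius (T : topologicalType) p q (X : T -> 'M[R]_(p, q)) (t : T) :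
  (forall i j, {for t, continuous (fun s => X s i j)}) ->
  frobenius (X s - X t) @[s --> t] --> (0 : R).
Proof.
move=> Xt; have -> : 0 = frobenius (X t - X t) :> R.
  rewrite /frobenius big1 ?sqrtr0// => i _; rewrite big1// => j _.
  by rewrite !mxE subrr expr0n.
apply: (@continuous_comp _ _ _ (fun s => \sum_i \sum_j (X s - X t) i j ^+ 2)
  (@Num.sqrt R)); last exact: sqrt_continuous.
apply: continuous_sum => i; apply: continuous_sum => j.
rewrite (_ : (fun s => _) = (fun s => (X s i j - X t i j) * (X s i j - X t i j))).
  by apply: continuousM; (apply: continuousB; [exact: Xt|exact: cst_continuous]).
by apply/funext => s; rewrite !mxE.
Qed.

(** Both extreme singular values inherit continuity at [t] from the entries through the Lipschitz
    bounds, and the denominator of the quotient is nonzero at [t]. *)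
Lemma continuous_kappa2 (T : topologicalType) p q (X : T -> 'M[R]_(p, q)) (t : T) :
  (0 < q)%N -> sigma_min (X t) != 0 ->
  (forall i j, {for t, continuous (fun s => X s i j)}) ->
  {for t, continuous (fun s => kappa2 (X s))}.
Proof.
move=> q0 Xt0 Xt; have X0 := cvg_frobenius Xt.
have lip (f : T -> R) : (forall s, `|f s - f t| <= frobenius (X s - X t)) ->
    {for t, continuous f}.
  move=> fX; apply/cvgrPdist_lt => e e0.
  have /cvgr0Pnorm_lt/(_ e e0) := X0; apply: filterS => s.
  rewrite ger0_norm ?sqrtr_ge0// => h.
  by rewrite distrC (le_lt_trans (fX s)).
apply: continuousM; first by apply: lip => s; exact: sigma_max_lip.
by apply: continuousV => //; apply: lip => s; exact: sigma_min_lip.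
Qed.

End SingularValues.

(** * Blockwise products and inverses of block diagonal matrices *)

Section BlockDiagonal.
Context {R : realType}.
Variables (n : nat) (q_ : 'I_n -> nat).
Implicit Types D E : forall j, 'M[R]_(q_ j).

Lemma mul_mxdiag D E :
  \mxdiag_j D j *m \mxdiag_j E j = \mxdiag_j (D j *m E j).
Proof.
rewrite [\mxdiag_j E j]/mxdiag mul_mxdiag_mxblock; apply/eq_mxblock => i j.
by case: eqVneq => [<-|_]; rewrite ?conform_mx_id ?mulmx0.
Qed.

Lemma mxdiag_mulV D E :
  (forall j, D j *m E j = 1%:M) -> \mxdiag_j D j *m \mxdiag_j E j = 1%:M.
Proof. by move=> DE; rewrite mul_mxdiag -mxdiagZ; apply: eq_mxdiag => j. Qed.

Lemma invmx_mxdiag D E :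
  (forall j, D j *m E j = 1%:M) -> invmx (\mxdiag_j D j) = \mxdiag_j E j.
Proof.
move=> /mxdiag_mulV DE; have [Du _] := mulmx1_unit DE.
by rewrite -[LHS]mulmx1 -DE mulKmx.
Qed.

End BlockDiagonal.

(** * Splitting products and norms over column blocks of width 2 *)

Section BlockColumns.
Context {R : realType}.
Variable n : nat.
Local Notation N := (\sum_(j < n) 2)%N.

(** The isometric embedding of the plane as the j-th block; it turns bounds for a whole matrix into
    bounds for one of its blocks. *)
Definition colblk (j : 'I_n) (x : 'cV[R]_2) : 'cV[R]_N :=
  \mxcol_i (if j == i then x else 0).

Lemma mulmx_blocks p (X : 'M[R]_(p, N)) (v : 'cV_N) :
  X *m v = \sum_j submxrow X j *m submxcol v j.
Proof. by rewrite -[X in LHS]submxrowK -[v in LHS]submxcolK mul_mxrow_mxcol. Qed.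

Lemma submxcol_colblk (j : 'I_n) (x : 'cV[R]_2) : submxcol (colblk j x) j = x.
Proof. by rewrite mxcolK eqxx. Qed.

Lemma submxcol_colblk_neq (j i : 'I_n) (x : 'cV[R]_2) :
  j != i -> submxcol (colblk j x) i = 0.
Proof. by move=> /negbTE ji; rewrite mxcolK ji. Qed.

Lemma mulmx_colblk p (X : 'M[R]_(p, N)) (j : 'I_n) (x : 'cV[R]_2) :
  X *m colblk j x = submxrow X j *m x.
Proof.
rewrite mulmx_blocks (bigD1 j)//= submxcol_colblk big1 ?addr0// => i ij.
by rewrite submxcol_colblk_neq ?mulmx0// eq_sym.
Qed.

Lemma sqr_norm2_blocks (v : 'cV[R]_N) :
  norm2 v ^+ 2 = \sum_j norm2 (submxcol v j) ^+ 2.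
Proof.
rewrite sqr_norm2 /dot mulmx_blocks summxE; apply: eq_bigr => j _.
by rewrite sqr_norm2 /dot -tr_submxcol.
Qed.

Lemma norm2_colblk (j : 'I_n) (x : 'cV[R]_2) : norm2 (colblk j x) = norm2 x.
Proof.
apply/eqP; rewrite -(eqrXn2 (n := 2)) ?norm2_ge0// sqr_norm2_blocks.
rewrite (bigD1 j)//= submxcol_colblk big1 ?addr0// => i ij.
rewrite submxcol_colblk_neq 1?eq_sym// sqr_norm2 dotE big1// => k _.
by rewrite mxE mul0r.
Qed.

Lemma colblk_eq0 (j : 'I_n) (x : 'cV[R]_2) : (colblk j x == 0) = (x == 0).
Proof. by apply: negb_inj; rewrite -!norm2_gt0 norm2_colblk. Qed.

Lemma submxrow_mul_mxdiag p (X : 'M[R]_(p, N)) (E : 'I_n -> 'M_2) j :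
  submxrow (X *m \mxdiag_i E i) j = submxrow X j *m E j.
Proof. by rewrite -[X in X *m _]submxrowK mul_mxrow_mxdiag mxrowK. Qed.

Lemma submxcol_mxdiag_mul (E : 'I_n -> 'M[R]_2) (v : 'cV_N) j :
  submxcol (\mxdiag_i E i *m v) j = E j *m submxcol v j.
Proof. by rewrite -[v in LHS]submxcolK mul_mxdiag_mxcol mxcolK. Qed.

Lemma sqr_frobenius p q (X : 'M[R]_(p, q)) :
  frobenius X ^+ 2 = \sum_k norm2 (col k X) ^+ 2.
Proof.
rewrite sqr_sqrtr; last first.
  by apply: sumr_ge0 => i _; apply: sumr_ge0 => j _; exact: sqr_ge0.
rewrite exchange_big; apply: eq_bigr => k _.
by rewrite sqr_norm2 dotE; apply: eq_bigr => i _; rewrite mxE expr2.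
Qed.

(** The squared Frobenius norm is the trace of the Gram matrix, and the trace of a block matrix is
    the sum of the traces of its diagonal blocks. *)
Lemma sqr_frobenius_blocks p (X : 'M[R]_(p, N)) :
  frobenius X ^+ 2 = \sum_j frobenius (submxrow X j) ^+ 2.
Proof.
have frobE q (Y : 'M[R]_(p, q)) : frobenius Y ^+ 2 = \tr (Y^T *m Y).
  rewrite sqr_frobenius; apply: eq_bigr => k _; rewrite sqr_norm2 dotE mxE.
  by apply: eq_bigr => i _; rewrite !mxE.
rewrite frobE -{1 2}[X]submxrowK tr_mxrow mul_mxcol_mxrow mxtrace_mxblock.
by apply: eq_bigr => j _; rewrite frobE.
Qed.

Lemma norm2_submxrow_le p (X : 'M[R]_(p, N)) j (x : 'cV[R]_2) :
  (0 < N)%N -> norm2 (submxrow X j *m x) <= sigma_max X * norm2 x.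
Proof.
move=> N0; have [_ Xv _] := sigma_max_spec X N0.
by rewrite -mulmx_colblk -(norm2_colblk j x).
Qed.

End BlockColumns.

(** * Explicit computations with 2 x 2 blocks *)

Section TwoByTwo.
Context {R : realType}.

(** The inverse of [Dblock c f] for nonzero [c]. *)
Definition Eblock (c f : R) : 'M[R]_2 := mx2 c^-1 (- f) 0 c.

Lemma ord2P (i : 'I_2) : i = 0 \/ i = 1.
Proof. by case: i => [[|[|//]] ?]; [left|right]; exact/val_inj. Qed.

Lemma big_ord2 (V : nmodType) (F : 'I_2 -> V) : \sum_i F i = F 0 + F 1.
Proof. by rewrite big_ord_recl big_ord1; congr (_ + F _); exact/val_inj. Qed.

Lemma mx2M (a b c d a' b' c' d' : R) : mx2 a b c d *m mx2 a' b' c' d' =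
  mx2 (a * a' + b * c') (a * b' + b * d') (c * a' + d * c') (c * b' + d * d').
Proof.
apply/matrixP => i j; rewrite mxE big_ord2.
by case: (ord2P i) => ->; case: (ord2P j) => ->; rewrite !mxE.
Qed.

Lemma mx2_scalar (a : R) : mx2 a 0 0 a = a%:M.
Proof.
apply/matrixP => i j.
by case: (ord2P i) => ->; case: (ord2P j) => ->; rewrite !mxE.
Qed.

Lemma mulDE (c f : R) : c != 0 -> Dblock c f *m Eblock c f = 1%:M.
Proof.
move=> c0; rewrite mx2M -mx2_scalar; congr mx2; rewrite ?mulfV ?mulVf//; ring.
Qed.

Lemma mulED (c f : R) : c != 0 -> Eblock c f *m Dblock c f = 1%:M.
Proof. by move=> c0; apply: mulmx1C; exact: mulDE. Qed.

Definition cv2 (x y : R) : 'cV[R]_2 := \col_i [:: x; y]`_i.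

Lemma cv2E (v : 'cV[R]_2) : v = cv2 (v 0 0) (v 1 0).
Proof. by apply/colP => i; case: (ord2P i) => ->; rewrite mxE. Qed.

Lemma sqr_norm2_cv2 (x y : R) : norm2 (cv2 x y) ^+ 2 = x ^+ 2 + y ^+ 2.
Proof. by rewrite sqr_norm2 dotE big_ord2 !mxE. Qed.

Lemma mx2_cv2 (a b c d x y : R) :
  mx2 a b c d *m cv2 x y = cv2 (a * x + b * y) (c * x + d * y).
Proof.
apply/colP => i; rewrite mxE big_ord2.
by case: (ord2P i) => ->; rewrite !mxE.
Qed.

Lemma mulmx_cv2 p (A : 'M[R]_(p, 2)) (x y : R) :
  A *m cv2 x y = x *: col 0 A + y *: col 1 A.
Proof.
by apply/colP => i; rewrite mxE big_ord2 !mxE/= mulrC [_ * y]mulrC.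
Qed.

Lemma sqr_norm2_mulmx_cv2 p (A : 'M[R]_(p, 2)) (x y : R) :
  norm2 (A *m cv2 x y) ^+ 2 = x ^+ 2 * norm2 (col 0 A) ^+ 2
    + 2 * x * y * dot (col 0 A) (col 1 A) + y ^+ 2 * norm2 (col 1 A) ^+ 2.
Proof.
rewrite mulmx_cv2 sqr_norm2D dotZl dotZr !norm2Z !exprMn !real_normK ?num_real//.
ring.
Qed.

Lemma det_gram2 p (A : 'M[R]_(p, 2)) : \det (A^T *m A) =
  norm2 (col 0 A) ^+ 2 * norm2 (col 1 A) ^+ 2 - dot (col 0 A) (col 1 A) ^+ 2.
Proof.
have gE i j : (A^T *m A) i j = dot (col i A) (col j A).
  by rewrite dotE mxE; apply: eq_bigr => k _; rewrite !mxE.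
move: gE; move: (A^T *m A) => G gE.
rewrite (expand_det_row _ 0) big_ord2 /cofactor !det_mx11 !mxE !gE.
rewrite (_ : lift 0 0 = 1); last exact/val_inj.
rewrite (_ : lift 1 0 = 0); last exact/val_inj.
rewrite !sqr_norm2 (dotC (col 1 A) (col 0 A)) /=; ring.
Qed.

(** A block of determinant 1 cannot lengthen every vector. If c^2 >= 1, the first basis vector is
    scaled by 1/c; otherwise (c f, 1) is sent to (0, c). *)
Lemma Eblock_contract (c f : R) : c != 0 ->
  exists2 x : 'cV[R]_2, x != 0 & norm2 (Eblock c f *m x) <= norm2 x.
Proof.
move=> c0; have nz x y : x ^+ 2 + y ^+ 2 != 0 :> R -> cv2 x y != 0.
  by rewrite -sqr_norm2_cv2 -norm2_gt0 lt_neqAle norm2_ge0 andbT sqrf_eq0 eq_sym.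
have [c1|c1] := leP 1 (c ^+ 2).
  exists (cv2 1 0); first by apply: nz; rewrite expr1n expr0n addr0 oner_neq0.
  rewrite -ler_sqr ?nnegrE ?norm2_ge0// mx2_cv2 !sqr_norm2_cv2.
  have -> : (c^-1 * 1 + - f * 0) ^+ 2 + (0 * 1 + c * 0) ^+ 2 = (c ^+ 2)^-1.
    by rewrite -exprVn; ring.
  have -> : 1 ^+ 2 + 0 ^+ 2 = 1 :> R by ring.
  by rewrite invf_le1// (lt_le_trans _ c1).
exists (cv2 (c * f) 1).
  by apply: nz; rewrite gt_eqF// expr1n ltr_wpDl// sqr_ge0.
rewrite -ler_sqr ?nnegrE ?norm2_ge0// mx2_cv2 !sqr_norm2_cv2.
rewrite mulKf// !mulr1 subrr mul0r add0r expr0n add0r expr1n.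
by rewrite (le_trans (ltW c1))// lerDr sqr_ge0.
Qed.

(* With [n = |s|], [b = s^T t] and [det = n^2 |t|^2 - b^2], both columns of the
   scaled block get norm [dl] and inner product [-+ h]. *)
Lemma check_block_norm p (A : 'M[R]_(p, 2)) (dl h e x y : R) :
  let n := norm2 (col 0 A) in let b := dot (col 0 A) (col 1 A) in
  n != 0 -> dl != 0 -> e ^+ 2 = 1 -> h ^+ 2 = dl ^+ 4 - \det (A^T *m A) ->
  norm2 (A *m Eblock (n / dl) ((b + e * h) / (n * dl)) *m cv2 x y) ^+ 2 =
  dl ^+ 2 * (x ^+ 2 + y ^+ 2) - 2 * (e * h) * x * y.
Proof.
move=> n b n0 dl0 e1; rewrite det_gram2 -/n -/b => hE.
rewrite -mulmxA mx2_cv2 sqr_norm2_mulmx_cv2 -/n -/b.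
have eh : (e * h) ^+ 2 = dl ^+ 4 - (n ^+ 2 * norm2 (col 1 A) ^+ 2 - b ^+ 2).
  by rewrite exprMn e1 mul1r.
(* Solving the hypothesis on [h] for the squared norm of the second column leaves a rational
   identity. *)
have -> : norm2 (col 1 A) ^+ 2 = (dl ^+ 4 - (e * h) ^+ 2 + b ^+ 2) / n ^+ 2.
  by rewrite eh; field.
by field; apply/andP.
Qed.

End TwoByTwo.

(** * Existence of an optimal block scaling *)

Section MinimalConditionNumber.
Context {R : realType}.
Variables (p n : nat) (S : 'M[R]_(p, \sum_(j < n) 2)).
Hypotheses (n_gt0 : (0 < n)%N)
  (S_inj : forall v : 'cV_(\sum_(j < n) 2), S *m v = 0 -> v = 0).
Local Notation N := (\sum_(j < n) 2)%N.
(** This is S D^-1 with the inverse written out, so that its entries are explicit functions of the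
    parameters. *)
Local Notation SE c f := (S *m \mxdiag_(j < n) Eblock (c j) (f j)).

Lemma block_dim_gt0 : (0 < N)%N.
Proof. by rewrite sum_nat_const card_ord muln_gt0 n_gt0. Qed.
Local Hint Resolve block_dim_gt0 : core.

Lemma mulSE_inj (c f : 'I_n -> R) : (forall j, c j != 0) ->
  forall v : 'cV_N, SE c f *m v = 0 -> v = 0.
Proof.
move=> c0 v; rewrite -mulmxA => /S_inj Ev.
rewrite -[v]mul1mx -(mxdiag_mulV (fun j => mulDE (f j) (c0 j))).
by rewrite -mulmxA Ev mulmx0.
Qed.

(** Test on a vector supported in the first block that its [Eblock] does not lengthen: only the
    stretching by [S] remains, uniformly in the parameters. *)
Lemma sigma_min_SE_le (c f : 'I_n -> R) : (forall j, c j != 0) ->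
  sigma_min (SE c f) <= sigma_max S.
Proof.
move=> c0; pose j := Ordinal n_gt0.
have [x x0 Ex] := Eblock_contract (f j) (c0 j).
have [_ Xv _] := sigma_min_spec (SE c f) block_dim_gt0.
have nx : 0 < norm2 x by rewrite norm2_gt0.
rewrite -(ler_pM2r nx).
have := Xv (colblk j x); rewrite norm2_colblk => /le_trans; apply.
rewrite mulmx_colblk submxrow_mul_mxdiag -mulmxA.
rewrite (le_trans (norm2_submxrow_le _ _ _ block_dim_gt0))//.
have [s0 _ _] := sigma_max_spec S block_dim_gt0.
exact: ler_wpM2l.
Qed.

(** On the sublevel set sigma_max (S E) <= |k| sigma_max S, while [S] stretches by at least
    sigma_min S. Hence every block of E has operator norm at most |k| sigma_max S / sigma_min S. The
    bound on 1/|c_j| is stated without division, as a closed condition that excludes c_j = 0. *)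
Lemma sublevel_bound (k : R) : exists2 B : R, 0 < B &
  forall c f : 'I_n -> R, (forall j, c j != 0) -> kappa2 (SE c f) <= k ->
  forall j, [/\ `|c j| <= B, 1 <= B * `|c j| & `|f j| <= B].
Proof.
have s0 := sigma_min_gt0 block_dim_gt0 S_inj.
have M0 : 0 <= sigma_max S by case: (sigma_max_spec S block_dim_gt0).
have [B B0 BS] : exists2 B, 0 <= B & `|k| * sigma_max S = B * sigma_min S.
  exists (`|k| * sigma_max S / sigma_min S); last by rewrite divfK ?gt_eqF.
  by rewrite divr_ge0 ?mulr_ge0// ltW.
(* [B] is only known to be nonnegative; adding 1 makes the bound positive. *)
exists (B + 1) => [|c f c0 kle j]; first by rewrite ltr_wpDl.
have X0 := sigma_min_gt0 block_dim_gt0 (mulSE_inj (f := f) c0).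
have XM : sigma_max (SE c f) <= `|k| * sigma_max S.
  have := le_trans kle (ler_norm k); rewrite ler_pdivrMr// => /le_trans; apply.
  by rewrite ler_wpM2l// sigma_min_SE_le.
have EB (x : 'cV_2) : norm2 (Eblock (c j) (f j) *m x) <= B * norm2 x.
  rewrite -(ler_pM2l s0) mulrCA mulrA -BS.
  have [_ Sv _] := sigma_min_spec S block_dim_gt0.
  rewrite -(norm2_colblk j (_ *m x)) (le_trans (Sv _))// mulmx_colblk mulmxA.
  rewrite -(submxrow_mul_mxdiag S (fun i => Eblock (c i) (f i))).
  rewrite (le_trans (norm2_submxrow_le _ _ _ block_dim_gt0))//.
  by rewrite ler_wpM2r ?norm2_ge0.
have E2 (x y : R) :
    norm2 (Eblock (c j) (f j) *m cv2 x y) ^+ 2 <= B ^+ 2 * (x ^+ 2 + y ^+ 2).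
  rewrite -sqr_norm2_cv2 -exprMn ler_sqr ?nnegrE ?mulr_ge0 ?norm2_ge0//.
have norm_le (a : R) : a ^+ 2 <= B ^+ 2 -> `|a| <= B.
  by move=> h; rewrite -ler_sqr ?nnegrE// real_normK ?num_real.
(* The two basis vectors are sent to the columns (1/c_j, 0) and (-f_j, c_j) of the block, which
   yields all three bounds. *)
have Ec : (c j)^-1 ^+ 2 <= B ^+ 2.
  have := E2 1 0; rewrite mx2_cv2 sqr_norm2_cv2.
  by rewrite !(mulr0, mulr1, mul0r, expr1n, expr0n, addr0)/= ?addr0 ?mulr1.
have Ef : f j ^+ 2 + c j ^+ 2 <= B ^+ 2.
  have := E2 0 1; rewrite mx2_cv2 sqr_norm2_cv2.
  by rewrite !(mulr0, mulr1, mul0r, expr1n, expr0n, add0r)/= ?add0r ?mulr1 sqrrN.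
have BB1 : B <= B + 1 by rewrite lerDl.
split.
- apply: le_trans BB1; apply: norm_le; apply: le_trans Ef; rewrite lerDr.
  exact: sqr_ge0.
- apply: le_trans (ler_wpM2r (normr_ge0 _) BB1).
  have {1}<- : `|(c j)^-1| * `|c j| = 1 by rewrite -normrM mulVf ?normr1.
  by rewrite ler_wpM2r// norm_le.
- apply: le_trans BB1; apply: norm_le; apply: le_trans Ef; rewrite lerDl.
  exact: sqr_ge0.
Qed.

(** The left half of [w] holds the c_j, the right half the f_j. Column [k] involves only the block
    [tagnat.sig1 k], with entries 1/c, -f, 0 and c. *)
Lemma continuous_SE_entry (w : 'rV[R]_(n + n)) i k :
  (forall j, w 0 (lshift n j) != 0) ->
  {for w, continuous (fun w : 'rV[R]_(n + n) =>
    (SE (fun j => w 0 (lshift n j)) (fun j => w 0 (rshift n j))) i k)}.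
Proof.
move=> w0; rewrite -[S]submxrowK.
rewrite (_ : (fun _ => _) = (fun w : 'rV[R]_(n + n) =>
  \sum_(l < 2) submxrow S (tagnat.sig1 k) i l *
    Eblock (w 0 (lshift n (tagnat.sig1 k))) (w 0 (rshift n (tagnat.sig1 k)))
      l (tagnat.sig2 k))); last first.
  by apply/funext => v; rewrite mul_mxrow_mxdiag !mxE.
apply: continuous_sum => l; apply: continuousM; first exact: cst_continuous.
case: (ord2P l) => ->; case: (ord2P (tagnat.sig2 k)) => ->.
- rewrite (_ : (fun _ => _) =
      (fun w : 'rV[R]_(n + n) => (w 0 (lshift n (tagnat.sig1 k)))^-1)).
    by apply: continuousV => //; exact: coord_continuous.
  by apply/funext => v; rewrite !mxE.
- rewrite (_ : (fun _ => _) =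
      (fun w : 'rV[R]_(n + n) => - w 0 (rshift n (tagnat.sig1 k)))).
    by apply: continuousN; exact: coord_continuous.
  by apply/funext => v; rewrite !mxE.
- rewrite (_ : (fun _ => _) = cst 0); first exact: cst_continuous.
  by apply/funext => v; rewrite !mxE.
- rewrite (_ : (fun _ => _) =
      (fun w : 'rV[R]_(n + n) => w 0 (lshift n (tagnat.sig1 k)))).
    exact: coord_continuous.
  by apply/funext => v; rewrite !mxE.
Qed.

Lemma compact_parameters (B : R) : compact [set w : 'rV[R]_(n + n) |
  forall j, [/\ `|w 0 (lshift n j)| <= B, 1 <= B * `|w 0 (lshift n j)|
    & `|w 0 (rshift n j)| <= B]].
Proof.
apply: bounded_closed_compact.
  exists B; split; first exact: num_real.
  move=> M BM w /= wB; rewrite [leLHS]/Num.norm/= mx_normrE.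
  (* The maximum defining the sup norm starts from 0, so a nonnegative bound is required; the index
     0 exists because n > 0. *)
  have B0 : 0 <= B by case: (wB (Ordinal n_gt0)) => h _ _; exact: le_trans h.
  apply: bigmax_le => [|[i j] _] /=; first by rewrite (le_trans B0)// ltW.
  rewrite ord1 (le_trans _ (ltW BM))//.
  by case: (split_ordP j) => l ->; case: (wB l).
have normc (k : 'I_(n + n)) : continuous (fun w : 'rV[R]_(n + n) => `|w 0 k|).
  move=> w; apply: (@continuous_comp _ _ _ (fun w : 'rV[R]_(n + n) => w 0 k)).
    exact: coord_continuous.
  exact: norm_continuous.
have normcM (k : 'I_(n + n)) (w : 'rV[R]_(n + n)) :
    {for w, continuous (fun w : 'rV[R]_(n + n) => B * `|w 0 k|)}.
  by apply: continuousM; [exact: cst_continuous|exact: normc].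
rewrite (_ : mkset _ = \bigcap_(j in setT)
  (((fun w : 'rV[R]_(n + n) => `|w 0 (lshift n j)|) @^-1` [set x | x <= B]) `&`
   (((fun w : 'rV[R]_(n + n) => B * `|w 0 (lshift n j)|) @^-1` [set x | 1 <= x]) `&`
   ((fun w : 'rV[R]_(n + n) => `|w 0 (rshift n j)|) @^-1` [set x | x <= B])))).
  apply: closed_bigI => j _; apply: closedI; last apply: closedI.
  - by apply: preimage_closed; [move=> w _; exact: normc|exact: closed_le].
  - by apply: preimage_closed; [move=> w _; exact: normcM|exact: closed_ge].
  - by apply: preimage_closed; [move=> w _; exact: normc|exact: closed_le].
apply/seteqP; split => w /= wB.
  by move=> j _; case: (wB j).
by move=> j; case: (wB j I) => ? [].
Qed.

Lemma min_kappa2_exists : exists c f : 'I_n -> R, (forall j, c j != 0) /\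
  forall c' f' : 'I_n -> R, (forall j, c' j != 0) ->
  kappa2 (SE c f) <= kappa2 (SE c' f').
Proof.
pose F (w : 'rV[R]_(n + n)) :=
  kappa2 (SE (fun j => w 0 (lshift n j)) (fun j => w 0 (rshift n j))).
pose par (c f : 'I_n -> R) : 'rV[R]_(n + n) := row_mx (\row_j c j) (\row_j f j).
have Fpar c f : F (par c f) = kappa2 (SE c f).
  congr (kappa2 (S *m _)); apply: eq_mxdiag => j.
  by rewrite /par row_mxEl row_mxEr !mxE.
(* The value at D = I serves as the level: the compact set [K] contains all parameters that do at
   least as well. *)
pose k0 := kappa2 (SE (fun=> 1) (fun=> 0)).
have [B B0 HB] := sublevel_bound k0.
pose K := [set w : 'rV[R]_(n + n) |
  forall j, [/\ `|w 0 (lshift n j)| <= B, 1 <= B * `|w 0 (lshift n j)|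
    & `|w 0 (rshift n j)| <= B]].
have parK c f : (forall j, c j != 0) -> kappa2 (SE c f) <= k0 -> K (par c f).
  by move=> c0 /(HB _ _ c0) h j; have := h j; rewrite /par row_mxEl row_mxEr !mxE.
have K_neq0 w : K w -> forall j, w 0 (lshift n j) != 0.
  move=> Kw j; apply/eqP => wj; have [_ + _] := Kw j.
  by rewrite wj normr0 mulr0 ler10.
have K0 : K !=set0.
  exists (par (fun=> 1) (fun=> 0)).
  by apply: parK => [j|]; [exact: oner_neq0|exact: lexx].
have [|w] := EVT_min_rV K0 (compact_parameters (B := B)) (f := F).
  apply: continuous_in_subspaceT => w; rewrite inE => /K_neq0 w0.
  apply: (continuous_kappa2 (X := fun w : 'rV[R]_(n + n) =>
    SE (fun j => w 0 (lshift n j)) (fun j => w 0 (rshift n j)))); first exact: block_dim_gt0.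
    rewrite gt_eqF// (sigma_min_gt0 block_dim_gt0)//.
    exact: mulSE_inj.
  by move=> i k; exact: continuous_SE_entry.
rewrite inE => Kw wmin.
exists (fun j => w 0 (lshift n j)), (fun j => w 0 (rshift n j)).
split=> [|c f c0]; first exact: K_neq0.
change (F w <= kappa2 (SE c f)).
(* Either the competitor lies in [K], or its value is at least [k0], which is already attained in
   [K]. *)
case/orP: (le_total (kappa2 (SE c f)) k0) => ck.
  by have := wmin (par c f); rewrite Fpar; apply; rewrite inE; exact: parK.
apply: le_trans ck; rewrite -[k0](Fpar (fun=> 1) (fun=> 0)).
apply: wmin; rewrite inE.
by apply: parK => [j|]; [exact: oner_neq0|exact: lexx].
Qed.

End MinimalConditionNumber.

(** * The explicit scaling and its distance from the optimum *)

Section CheckScaling.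
Context {R : realType}.

Lemma Jhat_mulmx_inj n (v : 'cV[R]_(\sum_(j < n) 2)) : Jhat n *m v = 0 -> v = 0.
Proof.
move=> Jv; have JJ : Jhat n *m Jhat n = (-1)%:M :> 'M[R]__.
  rewrite mul_mxdiag -mxdiagZ; apply: eq_mxdiag => j.
  by rewrite mx2M -mx2_scalar; congr mx2; ring.
have : (Jhat n *m Jhat n) *m v = 0 by rewrite -mulmxA Jv mulmx0.
by rewrite JJ mul_scalar_mx scaleN1r => /eqP; rewrite oppr_eq0 => /eqP.
Qed.

Variables (m n : nat) (S : 'M[R]_(m + m, \sum_(j < n) 2)) (sgn : 'I_n -> bool).
Hypotheses (n_gt0 : (0 < n)%N)
  (S_inj : forall v : 'cV_(\sum_(j < n) 2), S *m v = 0 -> v = 0).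
Local Notation d := (deltamax S).
Local Notation h j := (Num.sqrt (deltamax S ^+ 4 - detS S j)).
Local Notation X :=
  (S *m \mxdiag_(j < n) Eblock (ccheck S j) (fcheck S sgn j)).

Lemma Sblk_inj j (x : 'cV_2) : Sblk S j *m x = 0 -> x = 0.
Proof.
by rewrite -mulmx_colblk => /S_inj/eqP; rewrite colblk_eq0 => /eqP.
Qed.

Lemma norm2_scol_gt0 j : 0 < norm2 (scol S j).
Proof.
rewrite norm2_gt0; apply/eqP => s0.
have : cv2 1 0 = 0 :> 'cV[R]_2.
  by apply: (@Sblk_inj j); rewrite mulmx_cv2 scale0r addr0 scale1r.
by move=> /colP/(_ 0)/eqP; rewrite !mxE oner_eq0.
Qed.

(** Multiplied by |s|^2, the determinant is the squared norm of |s|^2 t - (s^T t) s, for s and t the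
    two columns of the block; this is nonzero because the block is injective. *)
Lemma detS_gt0 j : 0 < detS S j.
Proof.
have a0 := norm2_scol_gt0 j; rewrite -(pmulr_rgt0 _ (exprn_gt0 2 a0)).
have -> : norm2 (scol S j) ^+ 2 * detS S j = norm2 (Sblk S j *m
    cv2 (- dot (scol S j) (scoln S j)) (norm2 (scol S j) ^+ 2)) ^+ 2.
  by rewrite sqr_norm2_mulmx_cv2 /detS det_gram2 -/(scol S j) -/(scoln S j); ring.
rewrite exprn_gt0// norm2_gt0; apply/eqP => /Sblk_inj/colP/(_ 1)/eqP.
by rewrite !mxE/= sqrf_eq0 gt_eqF.
Qed.

Lemma delta_gt0 j : 0 < delta_ S j.
Proof. exact/powR_gt0/detS_gt0. Qed.

Lemma delta_pow4 j : delta_ S j ^+ 4 = detS S j.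
Proof.
rewrite /delta_ -powR_mulrn ?powR_ge0// -powRrM mulVf ?pnatr_eq0// powRr1//.
by rewrite ltW// detS_gt0.
Qed.

Lemma delta_le_max j : delta_ S j <= d.
Proof. exact: le_bigmax. Qed.

Lemma deltamax_gt0 : 0 < d.
Proof. exact: lt_le_trans (delta_gt0 (Ordinal n_gt0)) (delta_le_max _). Qed.

Lemma deltamin_gt0 : 0 < deltamin S.
Proof.
by apply: lt_bigmin => [|j _]; [exact: deltamax_gt0|exact: delta_gt0].
Qed.

Lemma deltamin_le j : deltamin S <= delta_ S j.
Proof. exact: bigmin_le. Qed.

Lemma ccheck_neq0 j : ccheck S j != 0.
Proof. by rewrite mulf_neq0 ?invr_eq0 ?gt_eqF ?norm2_scol_gt0 ?deltamax_gt0. Qed.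

(** The radicand is nonnegative since [detS S j] is the fourth power of [delta_ S j]; on a negative
    argument [Num.sqrt] would return 0. *)
Lemma sqr_h j : h j ^+ 2 = d ^+ 4 - detS S j.
Proof.
rewrite sqr_sqrtr// subr_ge0 -delta_pow4 ler_pXn2r ?delta_le_max// nnegrE ltW//.
  exact: delta_gt0.
exact: deltamax_gt0.
Qed.

Lemma sqr_norm2_Xblk j (x y : R) : norm2 (submxrow X j *m cv2 x y) ^+ 2 =
  d ^+ 2 * (x ^+ 2 + y ^+ 2) - 2 * ((-1) ^+ sgn j * h j) * x * y.
Proof.
rewrite submxrow_mul_mxdiag; apply: check_block_norm.
- by rewrite gt_eqF// norm2_scol_gt0.
- by rewrite gt_eqF// deltamax_gt0.
- by rewrite -exprM mulnC exprM sqrrN !expr1n.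
- exact: sqr_h.
Qed.

Lemma frobenius_X : frobenius X = Num.sqrt (2 * n)%:R * d.
Proof.
(* Columns are images of basis vectors, at which the cross term of [sqr_norm2_Xblk] vanishes. *)
have colX j k : norm2 (col k (submxrow X j)) ^+ 2 = d ^+ 2.
  case: (ord2P k) => ->.
    have <- : submxrow X j *m cv2 1 0 = col 0 (submxrow X j).
      by rewrite mulmx_cv2 scale0r addr0 scale1r.
    by rewrite sqr_norm2_Xblk; ring.
  have <- : submxrow X j *m cv2 0 1 = col 1 (submxrow X j).
    by rewrite mulmx_cv2 scale0r add0r scale1r.
  by rewrite sqr_norm2_Xblk; ring.
apply/eqP; rewrite -(eqrXn2 (n := 2)) ?mulr_ge0 ?sqrtr_ge0 ?(ltW deltamax_gt0)//.
rewrite sqr_frobenius_blocks exprMn [X in _ == X * _]sqr_sqrtr ?ler0n//.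
rewrite (eq_bigr (fun=> d ^+ 2 *+ 2)); last first.
  by move=> j _; rewrite sqr_frobenius big_ord2 !colX mulr2n.
by rewrite sumr_const card_ord -mulrnA mulr_natl mulnC.
Qed.

(** The difference of the two sides is h_j (x - y)^2 or h_j (x + y)^2, according to the sign
    chosen. *)
Lemma norm2_Xblk_ge j (v : 'cV[R]_2) :
  (d ^+ 2 - h j) * norm2 v ^+ 2 <= norm2 (submxrow X j *m v) ^+ 2.
Proof.
rewrite [v]cv2E sqr_norm2_Xblk sqr_norm2_cv2 -subr_ge0.
move: (v 0 0) (v 1 0) (sqrtr_ge0 (d ^+ 4 - detS S j)) => x y.
move: (h j) => k k0; have [->|->] : (-1) ^+ sgn j = 1 :> R \/ (-1) ^+ sgn j = -1 :> R.
- by case: (sgn j); [right|left].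
- have -> : d ^+ 2 * (x ^+ 2 + y ^+ 2) - 2 * (1 * k) * x * y -
    (d ^+ 2 - k) * (x ^+ 2 + y ^+ 2) = k * (x - y) ^+ 2 by ring.
  by rewrite mulr_ge0 ?sqr_ge0.
- have -> : d ^+ 2 * (x ^+ 2 + y ^+ 2) - 2 * (-1 * k) * x * y -
    (d ^+ 2 - k) * (x ^+ 2 + y ^+ 2) = k * (x + y) ^+ 2 by ring.
  by rewrite mulr_ge0 ?sqr_ge0.
Qed.

(* [X v = Y w] for [w = D Dc^-1 v], whose blocks satisfy [X_j v_j = Y_j w_j]. *)
Lemma norm2_X_ge (c f : 'I_n -> R) (g : R) (v : 'cV_(\sum_(j < n) 2)) :
  let Y := S *m \mxdiag_(j < n) Eblock (c j) (f j) in
  (forall j, c j != 0) -> 0 <= g -> (forall j, g ^+ 2 <= d ^+ 2 - h j) ->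
  sigma_min Y * g * norm2 v <= sigma_max Y * norm2 (X *m v).
Proof.
move=> Y c0 g0 gh; have N0 := block_dim_gt0 n_gt0.
have [sm0 Ym _] := sigma_min_spec Y N0; have [sM0 YM _] := sigma_max_spec Y N0.
pose w := \mxdiag_(j < n) Dblock (c j) (f j) *m
  (\mxdiag_(j < n) Eblock (ccheck S j) (fcheck S sgn j) *m v).
have XY : X *m v = Y *m w.
  rewrite -[Y *m w]mulmxA [\mxdiag__ _ *m w]mulmxA.
  by rewrite (mxdiag_mulV (fun j => mulED (f j) (c0 j))) mul1mx mulmxA.
have wj j : submxrow X j *m submxcol v j = submxrow Y j *m submxcol w j.
  rewrite !submxrow_mul_mxdiag !submxcol_mxdiag_mul.
  by rewrite -!mulmxA (mulmxA (Eblock (c j) _)) mulED// mul1mx.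
have gv : g * norm2 v <= sigma_max Y * norm2 w.
  rewrite -ler_sqr ?nnegrE ?mulr_ge0 ?norm2_ge0// !exprMn !sqr_norm2_blocks.
  rewrite !mulr_sumr; apply: ler_sum => j _; rewrite -[leRHS]exprMn.
  apply: (@le_trans _ _ (norm2 (submxrow X j *m submxcol v j) ^+ 2)).
    by apply: le_trans (norm2_Xblk_ge _ _); rewrite ler_wpM2r ?sqr_ge0.
  rewrite wj ler_sqr ?nnegrE ?mulr_ge0 ?norm2_ge0//.
  exact: norm2_submxrow_le.
rewrite -mulrA (le_trans (ler_wpM2l sm0 gv))// mulrCA ler_wpM2l// XY.
exact: Ym.
Qed.

(** To be used with [sM], [sm] the extreme singular values of [X] and [tM], [tm] those of [Y]. *)
Lemma ratio_le (K g sM sm tM tm : R) : 0 <= K -> 0 < g -> 0 < sm -> 0 < tm ->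
  sM <= K -> tm * g <= tM * sm -> sM / sm <= K / g * (tM / tm).
Proof.
move=> K0 g0 sm0 tm0 sMK h; rewrite mulf_div ler_pdivrMr// mulrAC.
rewrite ler_pdivlMr ?mulr_gt0// -mulrA (mulrC g).
by apply: le_trans (ler_wpM2l K0 h); rewrite ler_wpM2r// mulr_ge0 ?ltW.
Qed.

Lemma kappa2_X_le (c f : 'I_n -> R) : (forall j, c j != 0) ->
  kappa2 X <= Num.sqrt (2 * n)%:R *
    (d * Num.sqrt (d ^+ 2 + Num.sqrt (d ^+ 4 - deltamin S ^+ 4))
       / deltamin S ^+ 2) * kappa2 (S *m \mxdiag_(j < n) Eblock (c j) (f j)).
Proof.
move=> c0; set Y := S *m \mxdiag_(j < n) Eblock (c j) (f j).
have N0 := block_dim_gt0 n_gt0; have d0 := deltamax_gt0; have m0 := deltamin_gt0.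
set mu := deltamin S in m0 *; set H := Num.sqrt (d ^+ 4 - mu ^+ 4).
have mud : mu <= d.
  exact: le_trans (deltamin_le (Ordinal n_gt0)) (delta_le_max _).
have H0 : 0 <= H by exact: sqrtr_ge0.
have H2 : H ^+ 2 = d ^+ 4 - mu ^+ 4.
  by rewrite sqr_sqrtr// subr_ge0 ler_pXn2r// nnegrE ltW.
(* Strict because H^2 = d^4 - mu^4 with mu > 0. *)
have dH : 0 < d ^+ 2 - H.
  rewrite subr_gt0 -ltr_sqr ?nnegrE ?sqr_ge0// H2 -exprM gtrBl.
  exact: exprn_gt0.
have hH j : h j <= H.
  apply: ler_wsqrtr; rewrite lerD2l lerN2 -delta_pow4.
  by rewrite ler_pXn2r ?deltamin_le// nnegrE ltW// delta_gt0.
pose g := Num.sqrt (d ^+ 2 - H); have g0 : 0 < g by rewrite sqrtr_gt0.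
have Yinj := mulSE_inj S_inj (f := f) c0.
have Xinj := mulSE_inj S_inj (f := fcheck S sgn) ccheck_neq0.
have Ym0 : 0 < sigma_min Y := sigma_min_gt0 N0 Yinj.
have Xm0 : 0 < sigma_min X := sigma_min_gt0 N0 Xinj.
have [_ _ [u u0 Xu]] := sigma_min_spec X N0.
have nu : 0 < norm2 u by rewrite norm2_gt0.
have gh j : g ^+ 2 <= d ^+ 2 - h j by rewrite sqr_sqrtr ?lerD2l ?lerN2// ltW.
(* Evaluate [norm2_X_ge] at a vector [u] where [X] attains its least stretch. *)
have key : sigma_min Y * g <= sigma_max Y * sigma_min X.
  rewrite -(ler_pM2r nu).
  by have := norm2_X_ge f u c0 (ltW g0) gh; rewrite Xu mulrA.
have XM : sigma_max X <= Num.sqrt (2 * n)%:R * d.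
  by rewrite -frobenius_X; apply: sigma_max_le => // v; exact: norm2_mulmx_le.
(* Since (d^2 - H) (d^2 + H) = mu^4, the factor in the theorem is [d / g] with the denominator
   rationalised. *)
have -> : d * Num.sqrt (d ^+ 2 + H) / mu ^+ 2 = d / g.
  have gg : g * Num.sqrt (d ^+ 2 + H) = mu ^+ 2.
    rewrite -sqrtrM ?ltW// -subr_sqr H2 -exprM opprB addrC subrK.
    by rewrite (exprM mu 2 2) sqrtr_sqr ger0_norm ?sqr_ge0.
  have r0 : Num.sqrt (d ^+ 2 + H) != 0.
    by rewrite sqrtr_eq0 -ltNge ltr_wpDr// exprn_gt0.
  by rewrite -gg invfM mulrACA divff// mulr1.
rewrite [_ * (d / g)]mulrA; apply: (ratio_le _ g0 Xm0 Ym0 XM key).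
by rewrite mulr_ge0 ?sqrtr_ge0// ltW.
Qed.

End CheckScaling.

Theorem theorem4p5 (R : realType) (m n : nat) (n_gt0 : (0 < n)%N)
    (le_nm : (n <= m)%N) (S : 'M[R]_(m + m, \sum_(j < n) 2))
    (S_sympl : S^T *m Jmx m *m S = Jhat n) (sgn : 'I_n -> bool) :
  let delta := deltamax S in
  let mu := deltamin S in
  exists kmin : R,
    is_min [set kappa2 (S *m invmx D) | D in Dset n] kmin /\
    kmin <= kappa2 (S *m invmx (Dcheck S sgn)) /\
    kappa2 (S *m invmx (Dcheck S sgn)) <=
      Num.sqrt (2 * n)%:R *
      (delta * Num.sqrt (delta ^+ 2 + Num.sqrt (delta ^+ 4 - mu ^+ 4))
         / mu ^+ 2) * kmin.
Proof.
move=> delta mu.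
(* Full column rank comes from the symplectic relation: S v = 0 forces Jhat v = 0, and Jhat squares
   to -I. *)
have S_inj (v : 'cV_(\sum_(j < n) 2)) : S *m v = 0 -> v = 0.
  by move=> Sv; apply: Jhat_mulmx_inj; rewrite -S_sympl -mulmxA Sv mulmx0.
have invD (c f : 'I_n -> R) : (forall j, c j != 0) ->
    invmx (\mxdiag_(j < n) Dblock (c j) (f j)) = \mxdiag_(j < n) Eblock (c j) (f j).
  by move=> c0; apply: invmx_mxdiag => j; exact: mulDE.
have ck0 := ccheck_neq0 n_gt0 S_inj.
have [c [f [c0 cfmin]]] := min_kappa2_exists n_gt0 S_inj.
exists (kappa2 (S *m \mxdiag_(j < n) Eblock (c j) (f j))); split; last split.
- split; last by move=> _ [_ [c' [f' [c'0 ->]]] <-]; rewrite invD; [exact: cfmin|].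
  exists (\mxdiag_(j < n) Dblock (c j) (f j)); first by exists c, f.
  by rewrite (invD _ _ c0).
- by rewrite /Dcheck (invD _ _ ck0); exact: cfmin.
- by rewrite /Dcheck (invD _ _ ck0); exact: kappa2_X_le.
Qed.
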